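(* Let $\Omega$ be a topological signature and let $A$ be a Stone topological $\Omega$-algebra. Then $A$ is profinite if and only if, for every clopen subset $L$ of $A$, the syntactic congruence $\sigma_L^A$ is clopen (that is, $\sigma_L^A$ is a clopen subset of $A\times A$).
   Context: A topological signature is a sequence $\Omega=(\Omega_n)_{n\in\mathbb{N}}$ (with $0\in\mathbb{N}$) of topological spaces. An $\Omega$-algebra is a set $A$ with evaluation maps $E_n^A:\Omega_n\times A^n\to A$ ($n\in\mathbb{N}$); for $w\in\Omega_n$ write $w_A(a_1,\ldots,a_n)=E_n^A(w,a_1,\ldots,a_n)$. It is a topological $\Omega$-algebra if $A$ is a topological space and every $E_n^A$ is continuous. Compact spaces are required to be Hausdorff. A Stone space is a compact 0-dimensional space; a Stone topological algebra is a topological algebra whose underlying space is a Stone space. Finite algebras are viewed as discrete topological algebras (the evaluation maps being required to be continuous). A topological algebra $A$ is residually finite if for all distinct $a,a'\in A$ there is a continuous homomorphism $\varphi:A\to B$ into a finite (discrete) topological algebra with $\varphi(a)\neq\varphi(a')$; $A$ is profinite if it is compact and residually finite. Let $T_\Omega(X)$ be the algebra of $\Omega$-terms over the set of variables $X$. A term is linear in a variable $x$ if $x$ occurs in it exactly once. The translation monoid $M(A)$ is the set of all maps $A\to A$ of the form $a\mapsto t_A(a_1,\ldots,a_{i-1},a,a_{i+1},\ldots,a_m)$, where $t\in T_\Omega(\{x_1,\ldots,x_m\})$ is linear in $x_i$ and $a_j\in A$ ($j\ne i$). A congruence is an equivalence relation compatible with all operations $w_A$. The syntactic congruence $\sigma_L^A$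 of $L\subseteq A$ is $\{(a,a')\in A\times A:\forall f\in M(A)\ (f(a)\in L\iff f(a')\in L)\}$; it is the largest congruence on $A$ for which $L$ is a union of classes. *)

(* Defs.v *)
From HB Require Import structures.
From mathcomp Require Import all_boot all_order all_algebra.
From mathcomp Require Import all_classical all_reals all_analysis.

Set Implicit Arguments.
Unset Strict Implicit.
Unset Printing Implicit Defensive.

Local Open Scope classical_set_scope.

Definition topologicalSignature := nat -> topologicalType.

(* The power A^n is ['I_n -> A]; the notation {ptws 'I_n -> A} selects the
   product topology on it. *)
Record topologicalAlgebra (Omega : topologicalSignature) := TopologicalAlgebra {
  carrier :> topologicalType;
  evaluation : forall n, Omega n * {ptws 'I_n -> carrier} -> carrier;
  evaluation_continuous : forall n, continuous (evaluation (n := n))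
}.

Definition op (Omega : topologicalSignature) (A : topologicalAlgebra Omega)
    (n : nat) (w : Omega n) (a : 'I_n -> A) : A :=
  evaluation (w, a).

Inductive term (Omega : topologicalSignature) (X : Type) : Type :=
| Var (x : X)
| App (n : nat) (w : Omega n) (ts : 'I_n -> term Omega X).

Fixpoint eval_term (Omega : topologicalSignature)
    (A : topologicalAlgebra Omega) (X : Type) (t : term Omega X)
    (v : X -> A) : A :=
  match t with
  | Var x => v x
  | App n w ts => op w (fun i => eval_term (ts i) v)
  end.

Fixpoint occurrences (Omega : topologicalSignature) (X : eqType) (x : X)
    (t : term Omega X) : nat :=
  match t with
  | Var y => (y == x) : nat
  | App n w ts => (\sum_(i < n) occurrences x (ts i))%N
  end.

Definition linear_in (Omega : topologicalSignature) (X : eqType) (x : X)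
    (t : term Omega X) : Prop :=
  occurrences x t = 1%N.

(* The valuation giving [b] to the variable [i] and the parameters [a], in
   order, to the remaining ones. *)
Definition insert_at (A : Type) (k : nat) (i : 'I_k.+1) (a : 'I_k -> A)
    (b : A) : 'I_k.+1 -> A :=
  fun j => if unlift i j is Some l then a l else b.

(* The number m of variables is [k.+1]: it is nonzero, since the terms
   considered contain the variable [i]. *)
Definition translation_monoid (Omega : topologicalSignature)
    (A : topologicalAlgebra Omega) : set (A -> A) :=
  [set f | exists (k : nat) (t : term Omega 'I_k.+1) (i : 'I_k.+1)
             (a : 'I_k -> A),
             linear_in i t /\ f = (fun b => eval_term t (insert_at i a b))].
Arguments translation_monoid {Omega} A.

Definition syntactic_congruence (Omega : topologicalSignature)
    (A : topologicalAlgebra Omega) (L : set A) : set (A * A) :=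
  [set p | forall f : A -> A, translation_monoid A f ->
             (L (f p.1) <-> L (f p.2))].

Definition compact_hausdorff (T : topologicalType) : Prop :=
  compact [set: T] /\ hausdorff_space T.

(* Zero-dimensional means here that the clopen sets form a basis. The library's
   [zero_dimensional] only asks that they separate points, which is weaker in
   general, though equivalent for compact Hausdorff spaces. *)
Definition stone_space (T : topologicalType) : Prop :=
  compact_hausdorff T /\ basis (@clopen T).

Definition homomorphism (Omega : topologicalSignature)
    (A B : topologicalAlgebra Omega) (phi : A -> B) : Prop :=
  forall (n : nat) (w : Omega n) (a : 'I_n -> A),
    phi (op w a) = op w (fun i => phi (a i)).

Definition finite_discrete (T : topologicalType) : Prop :=
  finite_set [set: T] /\ forall U : set T, open U.

Definition residually_finite (Omega : topologicalSignature)
    (A : topologicalAlgebra Omega) : Prop :=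
  forall a a' : A, a <> a' ->
    exists (B : topologicalAlgebra Omega) (phi : A -> B),
      [/\ finite_discrete B, continuous phi, homomorphism phi
        & phi a <> phi a'].

Definition profinite (Omega : topologicalSignature)
    (A : topologicalAlgebra Omega) : Prop :=
  compact_hausdorff A /\ residually_finite A.

(* Main.v *)
Require Import Defs.
From HB Require Import structures.
From mathcomp Require Import all_boot all_order all_algebra.
From mathcomp Require Import all_classical all_reals all_analysis.

Set Implicit Arguments.
Unset Strict Implicit.
Unset Printing Implicit Defensive.

Local Open Scope classical_set_scope.
Local Open Scope quotient_scope.

(** Both properties say that [A] has enough open congruences, those being
    exactly the kernels of continuous homomorphisms to finite discrete
    algebras, and that an equivalence relation containing an open equivalence
    relation is clopen ([clopen_coarser]).

    Suppose [A] is profinite and [L] is clopen. Each pair in [L `*` ~` L] lies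
    outside some open congruence, and this product is compact; since open
    congruences are clopen and stable under finite intersection, a single open
    congruence avoids all of [L `*` ~` L], that is, saturates [L]
    ([exists_saturating_congruence]). A congruence is preserved by every
    translation, so it is contained in the syntactic congruence of [L]
    ([compatible_sub_syntactic]), which is therefore clopen.

    Conversely, the syntactic congruence of [L] is indeed a congruence, because
    precomposing a translation with a basic one, in which a single argument of
    an operation varies, gives a translation ([translation_monoid_op]). When it
    is open, the quotient of [A] by it is discrete, hence finite by
    compactness, and its operations are continuous ([finite_quotient]). As the
    identity is a translation, this quotient separates the points of [L] from
    those outside [L]; in a Stone space clopen sets separate points
    ([stone_separation]), so [A] is residually finite. *)

(** * Clopen equivalence relations and congruences *)

Section Congruences.
Variables (Omega : topologicalSignature) (A : topologicalAlgebra Omega).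
Implicit Types (theta sigma : set (A * A)) (L : set A).

Definition equivalence theta :=
  [/\ forall a, theta (a, a),
      forall a b, theta (a, b) -> theta (b, a) &
      forall a b c, theta (a, b) -> theta (b, c) -> theta (a, c)].

Definition compatible theta :=
  forall n (w : Omega n) (a b : 'I_n -> A),
    (forall i, theta (a i, b i)) -> theta (op w a, op w b).

Definition update_at n (a : 'I_n -> A) (j : 'I_n) (b : A) : 'I_n -> A :=
  fun i => if i == j then b else a i.

(** The arguments of an operation can be replaced one at a time; the
    intermediate argument tuples are the hybrids [h m] of [a] and [b], chained
    together by transitivity. *)
Lemma compatible_coordinatewise theta : equivalence theta ->
  (forall n (w : Omega n) (c : 'I_n -> A) (j : 'I_n) (a b : A),
     theta (a, b) -> theta (op w (update_at c j a), op w (update_at c j b))) ->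
  compatible theta.
Proof.
move=> [refl _ trans] coord n w a b ab.
pose h m : 'I_n -> A := fun i => if (i < m)%N then b i else a i.
suff hm m : (m <= n)%N -> theta (op w a, op w (h m)).
  have := hm n (leqnn n); congr (theta (_, op w _)).
  by apply/funext => i; rewrite /h ltn_ord.
elim: m => [_|m IH mn].
  by rewrite (_ : h 0%N = a)//; apply/funext.
apply: trans (IH (ltnW mn)) _.
have := coord n w (h m) (Ordinal mn) _ _ (ab (Ordinal mn)).
congr (theta (op w _, op w _)); apply/funext => i; rewrite /update_at /h.
  by case: eqP => // ->; rewrite /= ltnn.
case: eqP => [->|/eqP im]; first by rewrite /= ltnSn.
move: im; rewrite -val_eqE /= ltnS => im.
by rewrite [(i <= m)%N]leq_eqVlt (negbTE im).
Qed.

Lemma eval_term_compatible theta (X : Type) (t : term Omega X) (u v : X -> A) :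
  compatible theta -> (forall x, theta (u x, v x)) ->
  theta (eval_term t u, eval_term t v).
Proof.
move=> comp uv; elim: t => [x|n w ts IH] /=; first exact: uv.
exact: comp.
Qed.

Lemma nbhs_slice theta (a : A) :
  open theta -> theta (a, a) -> \forall b \near a, theta (a, b).
Proof.
move=> otheta aa.
have pair_cvg : (fun b => (a, b)) @ a --> (a, a).
  by apply: cvg_pair; [exact: cvg_cst|exact: cvg_id].
by apply: (pair_cvg theta); exact: open_nbhs_nbhs.
Qed.

(** Membership in [sigma] is constant on each product of two [theta]-classes,
    and these products are neighbourhoods of their points; thus [sigma] and its
    complement are both open. *)
Lemma clopen_coarser theta sigma : equivalence theta -> open theta ->
  equivalence sigma -> theta `<=` sigma -> clopen sigma.
Proof.
move=> [trefl _ _] otheta [_ sym trans] ts.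
have sat a b : \forall q \near (a, b), sigma (a, q.1) /\ sigma (b, q.2).
  exists ([set c | theta (a, c)], [set c | theta (b, c)]).
    by split; exact: nbhs_slice.
  by move=> q [/ts ? /ts ?].
split.
  rewrite openE => -[a b] /= ab; apply: filterS (sat a b) => -[c d] /= [ac bd].
  by apply: (trans _ a); [exact: sym|apply: trans bd].
rewrite -[sigma]setCK; apply: open_closedC.
rewrite openE => -[a b] /= nab.
apply: filterS (sat a b) => -[c d] /= [ac bd] cd.
apply: nab; apply: (trans _ c) => //; apply: (trans _ d) => //; exact: sym.
Qed.

(** * The syntactic congruence *)

Lemma syntactic_congruence_equivalence L : equivalence (syntactic_congruence L).
Proof.
split=> [a f _ //|a b ab f /ab []//|a b c ab bc f Mf].
by apply: (iff_trans (ab f Mf)); exact: bc.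
Qed.

(** One half of the maximality of the syntactic congruence: translations are
    term functions with fixed parameters, so they preserve [theta]. *)
Lemma compatible_sub_syntactic theta L : equivalence theta ->
  compatible theta -> (forall a b, theta (a, b) -> L a -> L b) ->
  theta `<=` syntactic_congruence L.
Proof.
move=> [refl sym _] comp sat [a b] ab f [k [t [i [c [_ ->]]]]] /=.
have tab : theta (eval_term t (insert_at i c a), eval_term t (insert_at i c b)).
  by apply: eval_term_compatible => // j; rewrite /insert_at; case: unlift.
by split; apply: sat => //; exact: sym.
Qed.

Fixpoint subst_term (X Y : Type) (s : X -> term Omega Y) (t : term Omega X) :
    term Omega Y :=
  match t with
  | Var x => s x
  | App n w ts => App w (fun i => subst_term s (ts i))
  end.

Lemma eval_subst_term (X Y : Type) (s : X -> term Omega Y) (t : term Omega X)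
    (v : Y -> A) :
  eval_term (subst_term s t) v = eval_term t (fun x => eval_term (s x) v).
Proof.
elim: t => //= n w ts IH.
by congr (op w _); apply/funext.
Qed.

(** When [y] occurs once in the term substituted for [x] and in no other
    substituted term, substitution turns linearity in [x] into linearity
    in [y]. *)
Lemma occurrences_subst_term (X Y : eqType) (s : X -> term Omega Y) (x : X)
    (y : Y) (t : term Omega X) :
  (forall z, occurrences y (s z) = (z == x)) ->
  occurrences y (subst_term s t) = occurrences x t.
Proof.
by move=> sy; elim: t => //= n w ts IH; apply: eq_bigr.
Qed.

(** Every valuation supplies parameters: it suffices to skip its value at the
    distinguished variable. *)
Lemma insert_at_lift k (v : 'I_k.+1 -> A) (i : 'I_k.+1) (b : A) :
  insert_at i (fun l => v (lift i l)) b = update_at v i b.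
Proof.
apply/funext => j; rewrite /insert_at /update_at.
case: unliftP => [l ->|->]; last by rewrite eqxx.
by rewrite eq_sym (negbTE (neq_lift _ _)).
Qed.

Lemma translation_monoid_id : translation_monoid A id.
Proof.
have a0 : 'I_0 -> A by case.
exists 0%N, (Var Omega ord0), ord0, a0.
split=> //.
by apply/funext => b /=; rewrite /insert_at unlift_none.
Qed.

(** If [f] comes from a term [t] linear in [x_i], then the new map comes from
    substituting [w] applied to [n] fresh variables for [x_i] in [t]. The fresh
    variables are placed after the old ones, in ['I_(k.+1 + n)], and the [j]-th
    of them becomes the distinguished one. *)
Lemma translation_monoid_op f n (w : Omega n) (c : 'I_n -> A) (j : 'I_n) :
  translation_monoid A f ->
  translation_monoid A (fun b => f (op w (update_at c j b))).
Proof.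
move=> [k [t [i [a [lin ->]]]]].
pose s (y : 'I_k.+1) : term Omega 'I_(k.+1 + n) :=
  if y == i then App w (fun l => Var Omega (rshift k.+1 l))
  else Var Omega (lshift n y).
(* The variable [x_i] no longer occurs, so its value [op w c] in [v] is
   arbitrary. *)
pose v (z : 'I_(k.+1 + n)) : A :=
  match fintype.split z with
  | inl y => insert_at i a (op w c) y
  | inr l => c l
  end.
pose x : 'I_(k + n).+1 := rshift k.+1 j.
have lx (y : 'I_k.+1) : (lshift n y == x) = false by exact: eq_lrshift.
have rx l : (rshift k.+1 l == x) = (l == j).
  by exact: (inj_eq (@rshift_inj _ _)).
exists (k + n)%N, (subst_term s t), x, (fun l => v (lift x l)); split.
  rewrite /linear_in -[RHS]lin; apply: occurrences_subst_term => y.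
  rewrite /s; case: eqP => _ /=; last by rewrite lx.
  by rewrite (bigD1 j)//= rx eqxx big1// => l lj; rewrite rx (negbTE lj).
apply/funext => b; rewrite insert_at_lift eval_subst_term.
congr (eval_term t _); apply/funext => y; rewrite /s.
case: eqP => [->|yi] /=.
  rewrite /insert_at unlift_none; congr (op w _); apply/funext => l.
  by rewrite /update_at rx /v (unsplitK (inr l)).
rewrite /update_at lx /v (unsplitK (inl y)) /insert_at.
by case: unliftP => [//|/yi].
Qed.

Lemma syntactic_congruence_compatible L : compatible (syntactic_congruence L).
Proof.
apply: compatible_coordinatewise => [|n w c j a b ab f Mf].
  exact: syntactic_congruence_equivalence.
exact: ab (translation_monoid_op w c j Mf).
Qed.

End Congruences.

(** * Finite discrete quotients *)

(** Near covering is applied along the filter of sets of points generated by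
    the sets containing a given finite set: each point [x] belongs to all sets
    containing [[set x]], so compactness yields a finite set containing every
    point. *)
Lemma compact_discrete_finite (T : topologicalType) :
  compact [set: T] -> (forall U : set T, open U) -> finite_set [set: T].
Proof.
move=> /compact_near_coveringP cT oT.
pose F := filter_from [set D : set T | finite_set D]
  (fun D => [set E | D `<=` E]).
have FF : Filter F.
  apply: filter_from_filter; first by exists set0; exact: finite_set0.
  move=> D E fD fE; exists (D `|` E); first by rewrite /= finite_setU.
  by move=> G DEG; split=> x ?; apply: DEG; [left|right].
have [x _|D fD /(_ D (@subset_refl _ _)) sD] := cT _ F (fun D x => D x) FF.
  exists ([set x], [set E | E x]) => /=.
    split; first exact: open_nbhs_nbhs.
    by exists [set x] => //= E; apply.
  by move=> [y E] /= [-> ].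
exact: sub_finite_set fD.
Qed.

Lemma continuous_postcomp (I : eqType) (S T : topologicalType) (r : S -> T) :
  continuous r ->
  continuous (fun b : {ptws I -> S} => (r \o b : {ptws I -> T})).
Proof.
move=> rc b; apply/cvg_sup => [|i].
  apply: fmap_filter; exact: (@nbhs_filter {ptws I -> S}).
apply: (@continuous_comp_initial {ptws I -> T} {ptws I -> S} T
  (fun f : I -> T => f i)) => {}b.
apply: (@continuous_comp _ _ _ (fun b : {ptws I -> S} => b i)); last exact: rc.
exact: (@proj_continuous _ (fun=> S)).
Qed.

Lemma continuous_map_snd (X S T : topologicalType) (g : S -> T) :
  continuous g -> continuous (fun p : X * S => (p.1, g p.2)).
Proof.
move=> cg p; apply: cvg_pair; first exact: cvg_fst.
by apply: (@continuous_comp _ _ _ snd); [exact: cvg_snd|exact: cg].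
Qed.

Section Quotient.
Variables (Omega : topologicalSignature) (A : topologicalAlgebra Omega).

(** The operations of the quotient are computed on representatives. Since the
    quotient [Q] is discrete, the choice [rp] of representatives is continuous,
    which makes the operations continuous as composites. *)
Lemma finite_quotient (theta : set (A * A)) :
  compact [set: A] -> equivalence theta -> compatible theta -> open theta ->
  exists (B : topologicalAlgebra Omega) (phi : A -> B),
    [/\ finite_discrete B, continuous phi, homomorphism phi
      & forall a b, phi a = phi b -> theta (a, b)].
Proof.
move=> cA [refl sym trans] comp otheta.
pose r : rel A := fun a b => `[< theta (a, b) >].
have rr : reflexive r by move=> a; exact/asboolP.
have rs : symmetric r by move=> a b; apply/asboolP/asboolP; exact: sym.
have rt : transitive r.
  by move=> b a c /asboolP ab /asboolP bc; apply/asboolP/(trans _ b).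
pose e := EquivRel r rr rs rt.
pose Q : topologicalType := quotient_topology {eq_quot e}.
pose pi : A -> Q := \pi_Q.
pose rp : Q -> A := repr.
have pi_cont : continuous pi by exact: pi_continuous.
have piP a b : pi a = pi b <-> theta (a, b).
  split=> [/eqmodP/asboolP//|ab]; apply/eqmodP; exact/asboolP.
have rpK q : pi (rp q) = q by exact: reprK.
have oQ (U : set Q) : open U.
  rewrite /open /= /quotient_open openE => a Ua.
  apply: filterS (nbhs_slice otheta (refl a)) => b /piP ab.
  by rewrite /= -[\pi_Q b]ab.
have rp_cont : continuous rp by apply/continuousP.
pose ev n (p : Omega n * {ptws 'I_n -> Q}) : Q := pi (op p.1 (rp \o p.2)).
have ev_cont n : continuous (@ev n).
  move=> p; apply: (@continuous_comp _ _ _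
    (fun p : Omega n * {ptws 'I_n -> Q} =>
       (p.1, rp \o p.2 : {ptws 'I_n -> A}))
    (fun p => pi (evaluation p))).
    apply: (@continuous_map_snd _ {ptws 'I_n -> Q} {ptws 'I_n -> A}).
    exact: continuous_postcomp.
  by apply: continuous_comp; [exact: evaluation_continuous|exact: pi_cont].
exists (TopologicalAlgebra ev_cont), pi; split=> //.
- split=> //; apply: compact_discrete_finite => //.
  rewrite (_ : setT = pi @` setT).
    by apply: continuous_compact => //; exact: continuous_subspaceT.
  by apply/seteqP; split=> // q _; exists (rp q).
- move=> n w a; apply/piP; apply: comp => i.
  by apply/piP; rewrite /= rpK.
- by move=> a b /piP.
Qed.

(** * Profinite algebras and Stone spaces *)

Lemma kernel_open_congruence (B : topologicalAlgebra Omega) (phi : A -> B) :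
  (forall U : set B, open U) -> continuous phi -> homomorphism phi ->
  let theta := [set p : A * A | phi p.1 = phi p.2] in
  [/\ equivalence theta, compatible theta & open theta].
Proof.
move=> oB cphi hphi; split.
- by split=> [a|a b|a b c] //= -> .
- move=> n w a b ab; rewrite /= !hphi; congr op.
  by apply/funext => i; exact: ab.
- have near_fiber a : \forall b \near a, phi b = phi a.
    by apply: (cphi a [set phi a]); exact: open_nbhs_nbhs.
  rewrite openE => -[a b] /= ab.
  exists ([set c | phi c = phi a], [set c | phi c = phi b]).
    by split; exact: near_fiber.
  by move=> [c d] /= [-> ->].
Qed.

(** The finite intersections of the compactness argument are absorbed in a
    filter: [F] consists of the families of relations containing all
    subrelations of some open congruence, and it is a filter because open
    congruences are stable under binary intersection. Near covering then
    produces one open congruence disjoint from [L `*` ~` L]. *)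
Lemma exists_saturating_congruence (L : set A) :
  profinite A -> clopen L ->
  exists theta : set (A * A),
    [/\ equivalence theta, compatible theta, open theta &
      forall a b, theta (a, b) -> L a -> L b].
Proof.
move=> [[cA _] rfA] [oL cL].
pose openCong := [set theta : set (A * A) |
  [/\ equivalence theta, compatible theta & open theta]].
pose F := filter_from openCong (fun theta => [set theta' | theta' `<=` theta]).
have FF : Filter F.
  apply: filter_from_filter.
    by exists setT; split=> //; exact: openT.
  move=> s t [[sr ss st] sc so] [[tr ts tt] tc to]; exists (s `&` t).
    split; last exact: openI.
      split=> [a|a b [/ss ? /ts ?]|a b c [ab ab'] [bc bc']] //.
      by split; [exact: st bc|exact: tt bc'].
    by move=> n w a b ab; split; [apply: sc|apply: tc] => i; case: (ab i).
  by move=> u ust; split=> p /ust [].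
have cLL : compact (L `*` ~` L).
  apply: compact_setX; apply: (subclosed_compact _ cA) => //.
  exact: open_closedC.
have [[a b] [/= La Lb]|theta [eqt comp ot] /(_ theta (@subset_refl _ _)) sat] :=
    (compact_near_coveringP _).1 cLL _ F (fun t p => ~ t p) FF.
  have ab : a <> b by move=> ab; apply: Lb; rewrite -ab.
  have [B [phi [[_ oB] cphi hphi nab]]] := rfA _ _ ab.
  have [eqt comp ot] := kernel_open_congruence oB cphi hphi.
  set theta := [set p | _] in eqt comp ot.
  (* [~` theta] is a neighbourhood of [(a, b)] because the open equivalence
     relation [theta] is also closed. *)
  exists (~` theta, [set t | t `<=` theta]); last first.
    by move=> [p t] /= [np tt] /tt.
  split; last by exists theta.
  apply: open_nbhs_nbhs; split=> //; apply: closed_openC.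
  by have [] := clopen_coarser eqt ot eqt (@subset_refl _ _).
exists theta; split=> // a b ab La; apply: contrapT => nLb.
exact: sat (a, b) (conj La nLb) ab.
Qed.

End Quotient.

Lemma stone_separation (T : topologicalType) (a b : T) :
  stone_space T -> a <> b -> exists L : set T, [/\ clopen L, L a & ~ L b].
Proof.
move=> [[_ hT] [_ bT]] /eqP ab.
have [U [oU /set_mem aU /set_mem bU]] := hausdorff_accessible hT ab.
have [L [cL La] LU] : filter_from [set U | clopen U /\ U a] id U.
  by apply: bT; exact: open_nbhs_nbhs.
by exists L; split=> // /LU /bU.
Qed.

Theorem theorem4p1 (Omega : topologicalSignature)
    (A : topologicalAlgebra Omega) (stoneA : stone_space A) :
  profinite A <->
  forall L : set A, clopen L -> clopen (syntactic_congruence L).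
Proof.
split=> [profA L cL|clopenA].
  have [theta [eqt comp ot sat]] := exists_saturating_congruence profA cL.
  apply: (clopen_coarser eqt ot); first exact: syntactic_congruence_equivalence.
  exact: compatible_sub_syntactic.
have [chA _] := stoneA; split=> // a b ab.
have [L [cL La nLb]] := stone_separation stoneA ab.
have [oS _] := clopenA L cL.
have [B [phi [finB cphi hphi phiP]]] := finite_quotient chA.1
  (@syntactic_congruence_equivalence _ _ L)
  (@syntactic_congruence_compatible _ _ L) oS.
exists B, phi; split=> // /phiP /(_ id (@translation_monoid_id _ A)) /= LL.
by apply: nLb; exact: LL.1.
Qed.
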